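(* Let $k$ be a field of characteristic $0$, let $p(t)$ be the Hilbert polynomial of some closed subscheme of $\mathbb{P}^n=\mathbb{P}^n_k$, and let $r,p,N,q$ be as in the context. The universal family $\mathcal{F}\hookrightarrow\mathbb{P}^n\times\mathbf{Gr}_p^N\to\mathbf{Gr}_p^N$ parameterized by the Grassmannian is generated by the set of bi-homogeneous elements in $k[\Delta,x]$ $$\Big\{\delta^{(1)}_{\mathcal{K}}=\sum_{h\in\mathcal{K}}\varepsilon^{\mathcal{K}}_{\{h\}}\,\Delta_{\mathcal{K}\setminus\{h\}}\,x^{\alpha(h)}\ \Big|\ \mathcal{K}\in\mathcal{E}^{(1)}\Big\},$$ and, for every $1\le m\le q$, the $m$-th exterior power of the universal element is generated by $$\Big\{\delta^{(m)}_{\mathcal{K}}=\sum_{\mathcal{H}\subset\mathcal{K},\ |\mathcal{H}|=m}\varepsilon^{\mathcal{K}}_{\mathcal{H}}\,\Delta_{\mathcal{K}\setminus\mathcal{H}}\,x^{\alpha(h_1)}\wedge\dots\wedge x^{\alpha(h_m)}\ \Big|\ \mathcal{K}\in\mathcal{E}^{(m)}\Big\}.$$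
   Context: The Gotzmann number $r$ of $p(t)$ is the number of summands in the unique expression $p(t)=\sum_{i=1}^{r}\binom{t+a_i-i+1}{a_i}$ with $a_1\ge\dots\ge a_r\ge 0$; $N=\binom{n+r}{n}$, $p=p(r)$, $q=N-p$. Variables are ordered $x_0<\dots<x_n$ and $x^{\alpha(1)},\dots,x^{\alpha(N)}$ are the monomials of degree $r$ in descending degree reverse lexicographic order. The Grassmannian $\mathbf{Gr}_p^N$ represents the functor sending a noetherian $k$-algebra $A$ to the set of submodules $L\subseteq A^N$ such that $A^N/L$ is locally free of rank $p$. The standard basis $\mathrm{a}_1,\dots,\mathrm{a}_N$ of $A^N$ is identified with $x^{\alpha(1)},\dots,x^{\alpha(N)}$, so $A^N\simeq H^0(\mathcal{O}_{\mathbb{P}^n_A}(r))$. The universal element is the tautological subsheaf $\mathcal{L}\subset\mathcal{O}_{\mathbf{Gr}}\otimes_k H^0(\mathcal{O}_{\mathbb{P}^n}(r))$, and $\mathcal{F}\subset\mathbb{P}^n\times\mathbf{Gr}_p^N$ is the closed subscheme whose ideal is generated by $\mathcal{L}$. An $s$-multi-index is an increasing sequence of $s$ elements of $\{1,\dots,N\}$ (also regarded as a set); $\mathcal{E}^{(m)}$ is the set of all $(p+m)$-multi-indices; $\mathcal{H}=(h_1,\dots,h_m)$. For $\mathcal{H}\subseteq\mathcal{K}$, $\varepsilon^{\mathcal{K}}_{\mathcal{H}}$ is the signature of the permutation $\mathcal{K}\mapsto\mathcal{H},\mathcal{K}\setminus\mathcal{H}$. The Plücker embedding is $\mathbf{Gr}_p^N=\operatorname{Proj}k[\Delta]\subset\mathbb{P}^E$,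 $E+1=\binom{N}{p}$, where $k[\Delta]$ is the homogeneous coordinate ring (polynomial ring in variables indexed by $\mathcal{E}^{(0)}$ modulo Plücker relations) and $\Delta_{\mathcal{J}}$ evaluates at $L$ to the image of $\mathrm{a}_{j_1}\wedge\dots\wedge\mathrm{a}_{j_p}$ in $\wedge^p(A^N/L)$ (which is identified with $A$ when free; defined up to a common unit). ''Generated'' means: the $\delta^{(m)}_{\mathcal{K}}$, regarded as sections of $\wedge^m(\mathcal{O}_{\mathbf{Gr}}\otimes H^0(\mathcal{O}_{\mathbb{P}^n}(r)))\otimes\mathcal{O}_{\mathbf{Gr}}(1)$, generate the subsheaf $\wedge^m\mathcal{L}\otimes\mathcal{O}_{\mathbf{Gr}}(1)$ (equivalently, for every $L$ in a standard open chart over $A$, the evaluations of the $\delta^{(m)}_{\mathcal{K}}$ at $L$ generate the $A$-module $\wedge^mL\subseteq\wedge^mA^N$); for $m=1$ the bi-homogeneous polynomials $\delta^{(1)}_{\mathcal{K}}$ generate the ideal defining $\mathcal{F}$. *)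

(* Defs.v *)
From HB Require Import structures.
From mathcomp Require Import all_boot all_order all_algebra all_fingroup.
From mathcomp Require Import generic_quotient ring_quotient.
From mathcomp Require Import boolp.
From mathcomp.multinomials Require Import mpoly.

Set Implicit Arguments.
Unset Strict Implicit.
Unset Printing Implicit Defensive.

Import GRing.Theory.

Local Open Scope ring_scope.

Inductive lspan (R : pzRingType) (V : lmodType R) (S : V -> Prop) : V -> Prop :=
| lspan0 : lspan S 0
| lspanZD (a : R) (u v : V) : S u -> lspan S v -> lspan S (a *: u + v).

Definition ideal_gen (R : comNzRingType) (S : R -> Prop) : R -> Prop :=
  @lspan R R^o S.

Definition is_ideal (R : comNzRingType) (I : R -> Prop) : Prop :=
  I 0 /\ forall a u v : R, I u -> I v -> I (a * u + v).

Definition noetherian (R : comNzRingType) : Prop :=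
  forall I : R -> Prop, is_ideal I ->
    exists s : seq R, forall f, I f <-> ideal_gen (fun g => g \in s) f.

Definition homogeneous_ideal (k : fieldType) (v : nat)
    (I : {mpoly k[v]} -> Prop) : Prop :=
  is_ideal I /\ forall f d, I f -> I (pihomog mdeg d f).

(* Closed subschemes of P^n are Proj (S/I) with I a homogeneous ideal of
   S = k[x_0..x_n]; the Hilbert polynomial is the value of dim (S/I)_t for
   t large.  The subspace It of the forms of degree t is I_t. *)
Definition hilbert_polynomial (k : fieldType) (n : nat)
    (I : {mpoly k[n.+1]} -> Prop) (hp : {poly rat}) : Prop :=
  exists t0 : nat, forall t : nat, (t0 <= t)%N ->
    exists It : {vspace dhomog n.+1 k t},
      (forall f : dhomog n.+1 k t, f \in It <-> I (mpoly_of_dhomog f)) /\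
      hp.[t%:R] = (\dim (fullv : {vspace dhomog n.+1 k t}))%:R - (\dim It)%:R.

(* binom_poly c a is the polynomial binomial(t + c, a) in t. *)
Definition binom_poly (c : rat) (a : nat) : {poly rat} :=
  (a`!%:R)^-1 *: \prod_(j < a) ('X + (c - j%:R)%:P).

(* The summation index is i - 1 for the usual i = 1..r, so that the shift
   a_i - i + 1 becomes a_i - i. *)
Definition gotzmann_number (hp : {poly rat}) (r : nat) : Prop :=
  exists a : seq nat, [/\ size a = r, sorted geq a &
    hp = \sum_(i < r) binom_poly ((nth 0%N a i)%:R - i%:R) (nth 0%N a i)].

(* a >= b for the degree reverse lexicographic order with x_0 < x_1 < ... :
   in equal degrees, the larger monomial has the smaller exponent at the
   smallest variable where the exponents differ. *)
Definition drl_ge (v : nat) (a b : 'X_{1..v}) : bool :=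
  (mdeg b < mdeg a)%N || (mdeg a == mdeg b) &&
    ((a == b) || [exists i : 'I_v, (a i < b i)%N &&
                   [forall j : 'I_v, (j < i)%N ==> (a j == b j)]]).

Definition monomials (v r : nat) : seq 'X_{1..v} :=
  sort (@drl_ge v)
    [seq bmnm m | m <- enum [pred m : 'X_{1..v < r.+1} | mdeg m == r]].

Definition alpha (v r N : nat) (h : 'I_N) : 'X_{1..v} :=
  nth 0%MM (monomials v r) h.

(* A multi-index is encoded by its underlying set; mi_nth lists its elements
   in increasing order. *)
Definition mindex (N s : nat) : finType := {J : {set 'I_N} | #|J| == s}.
Definition mi_nth (N s : nat) (J : mindex N s) (i : 'I_s) : 'I_N :=
  enum_val (cast_ord (esym (eqP (valP J))) i).

(* The permutation K |-> H, K \ H, read on the positions of the elements of K;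
   the default values are never reached when H is a subset of K. *)
Definition shuffle (N : nat) (K H : {set 'I_N}) : {perm 'I_#|K|} :=
  insubd (1%g : {perm 'I_#|K|}) [ffun i : 'I_#|K| => insubd i
    (index (nth (enum_val i) (enum H ++ enum (K :\: H)) i) (enum K))].
Definition eps (R : pzRingType) (N : nat) (K H : {set 'I_N}) : R :=
  (-1) ^+ shuffle K H.

Definition plring (k : fieldType) (N p : nat) := {mpoly k[#|mindex N p|]}.

(* The Pluecker variable of J, for #|J| = p (and 0 otherwise). *)
Definition plvar (k : fieldType) (N p : nat) (J : {set 'I_N}) : plring k N p :=
  if insub J is Some J' then 'X_(enum_rank (J' : mindex N p)) else 0.

(* sum_(j in J) +- X_(j,I) X_(J \ j), where X_(j,I) is alternating: it is 0 if
   j \in I and eps^(j |: I)_j X_(j |: I) otherwise. *)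
Definition plrel (k : fieldType) (N p : nat) (I J : {set 'I_N}) : plring k N p :=
  \sum_(j in J :\: I) (eps _ (j |: I) [set j] * plvar k p (j |: I)) *
                      (eps _ J [set j] * plvar k p (J :\ j)).

Definition plideal (k : fieldType) (N p : nat) : pred (plring k N p) :=
  fun f => `[< ideal_gen (fun g : plring k N p =>
    exists I J : {set 'I_N}, [/\ #|I|.+1 = p, #|J| = p.+1 & g = plrel k p I J]) f >].

Definition minor (A : comNzRingType) (N p : nat) (phi : 'M[A]_(N, p))
    (J : mindex N p) : A := \det (rowsub (mi_nth J) phi).
Lemma minor_seq (A : comNzRingType) N p (phi : 'M[A]_(N, p)) (J H : {set 'I_N}) (d : 'I_N) (hJ : #|J| == p) :
  H \subset J ->
  \det (rowsub (fun i : 'I_p => nth d (enum H ++ enum (J :\: H)) i) phi) =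
  eps A J H * minor phi (Sub J hJ).
Proof.
move=> sHJ; set l := enum H ++ _.
move/eqP: (hJ) => eJ; case: p / eJ phi hJ => phi hJ.
have perm_l : perm_eq l (enum J).
  apply: uniq_perm; rewrite ?enum_uniq //.
    rewrite cat_uniq !enum_uniq /= andbT; apply/hasPn => x.
    by rewrite !mem_enum inE => /andP[].
  move=> x; rewrite mem_cat !mem_enum inE.
  by have [/(subsetP sHJ) ->|] := boolP (x \in H).
have sz_l : size l = #|J| by rewrite (perm_size perm_l) -cardE.
rewrite /eps /shuffle -/l.
set f := [ffun i => _].
have fE i : enum_val (f i) = nth d l i.
  have li : nth d l i \in enum J.
    by rewrite -(perm_mem perm_l) mem_nth // sz_l.
  have lti : (index (nth d l i) (enum J) < #|J|)%N.
    by move: li; rewrite -index_mem -cardE.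
  have dE : nth (enum_val i) l i = nth d l i.
    by apply: set_nth_default; rewrite sz_l.
  by rewrite ffunE (enum_val_nth d) val_insubd dE ifT ?nth_index.
have f_inj : injectiveb f.
  apply/injectiveP => i j /(congr1 (fun x => enum_val x)); rewrite !fE.
  move/eqP; rewrite nth_uniq ?sz_l ?(perm_uniq perm_l) ?enum_uniq //.
  by move/eqP/val_inj.
set s := insubd _ _.
have sE i : s i = f i by rewrite -pvalE /s insubdK.
rewrite -det_perm -det_mulmx -row_permE; congr (\det _).
apply/matrixP => i j; rewrite !mxE /mi_nth; congr (phi _ _).
rewrite -fE -sE. congr enum_val. exact: val_inj.
Qed.

Definition pminor (A : comNzRingType) (N p : nat) (phi : 'M[A]_(N, p))
    (J : {set 'I_N}) : A := if insub J is Some J' then minor phi J' else 0.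

Lemma pminor_seq (A : comNzRingType) N p (phi : 'M[A]_(N, p))
    (J H : {set 'I_N}) (d : 'I_N) : #|J| = p -> H \subset J ->
  \det (rowsub (fun i : 'I_p => nth d (enum H ++ enum (J :\: H)) i) phi) =
  eps A J H * pminor phi J.
Proof.
move=> /eqP hJ sHJ; rewrite (minor_seq _ _ hJ sHJ) /pminor.
by rewrite (insubT (fun J : {set 'I_N} => #|J| == p) hJ).
Qed.

Lemma det_cons (A : comNzRingType) N p (c : 'cV[A]_N) (phi : 'M[A]_(N, p))
    (J : 'I_p.+1 -> 'I_N) :
  \det (rowsub J (row_mx c phi : 'M_(N, 1 + p)) : 'M_(p.+1)) =
  \sum_i c (J i) 0 * ((-1) ^+ i * \det (rowsub (J \o lift i) phi)).
Proof.
rewrite (expand_det_col _ 0); apply: eq_bigr => i _; congr (_ * _).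
  rewrite !mxE; case: splitP => [j _ | j /= ej]; first by rewrite (ord1 j).
  by [].
rewrite /cofactor addn0; congr (_ * \det _); apply/matrixP => a b.
rewrite !mxE; case: splitP => [j /= ej | j /= ej].
  by have := ltn_ord j; rewrite -ej.
by congr (phi _ _); apply: val_inj; move: ej => /= /(congr1 predn).
Qed.

Lemma pminorE (A : comNzRingType) N p (phi : 'M[A]_(N, p)) (J : {set 'I_N})
    (d : 'I_N) : #|J| = p ->
  pminor phi J = \det (rowsub (fun i : 'I_p => nth d (enum J) i) phi).
Proof.
move=> /eqP hJ; rewrite /pminor (insubT (fun J : {set 'I_N} => #|J| == p) hJ).
congr (\det _); apply/matrixP => i j; rewrite !mxE; congr (phi _ _).
by rewrite /mi_nth (enum_val_nth d).
Qed.

Lemma pminor_rel (A : comNzRingType) N p (phi : 'M[A]_(N, p))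
    (I J : {set 'I_N}) : #|I|.+1 = p -> #|J| = p.+1 ->
  \sum_(j in J :\: I) (eps _ (j |: I) [set j] * pminor phi (j |: I)) *
                      (eps _ J [set j] * pminor phi (J :\ j)) = 0.
Proof.
move=> hI hJ; have eJ : #|J| == p.+1 by rewrite hJ.
pose J' : mindex N p.+1 := Sub J eJ.
pose C (i : 'I_p.+1) := (-1) ^+ i * \det (rowsub (mi_nth J' \o lift i) phi).
have [d _] : exists d, d \in J by apply/card_gt0P; rewrite hJ.
pose lam j := \det (rowsub (fun i : 'I_p => nth d (j :: enum I) i) phi).
have J'in i : mi_nth J' i \in J by apply: (enum_valP (A := J)).
have second j : j \in J ->
    eps A J [set j] * pminor phi (J :\ j) = \sum_i (mi_nth J' i == j)%:R * C i.
  move=> jJ; pose c : 'cV[A]_N := \col_a (a == j)%:R.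
  have sjJ : [set j] \subset J by rewrite sub1set.
  have hJj : #|J :\ j| = p by have := cardsD1 j J; rewrite jJ hJ add1n => -[<-].
  have := minor_seq (row_mx c phi : 'M_(N, 1 + p)) d eJ sjJ.
  rewrite /minor -/J' !det_cons enum_set1 big_ord_recl big1 ?addr0; last first.
    move=> i _; rewrite mxE /=.
    have : nth d (enum (J :\ j)) i \in J :\ j.
      by rewrite -mem_enum mem_nth // -cardE hJj.
    by rewrite !inE => /andP[/negPf-> _]; rewrite mul0r.
  rewrite mxE eqxx mul1r expr0 mul1r (pminorE _ d hJj) => dE.
  transitivity (eps A J [set j] * (eps A J [set j] *
      \sum_i (mi_nth J' i == j)%:R * C i)); last first.
    by rewrite mulrA /eps -expr2 sqrr_sign mul1r.
  congr (_ * _); move: dE; under eq_bigr => i _ do rewrite mxE.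
  by move=> <-.
have first j : j \in J :\: I -> eps A (j |: I) [set j] * pminor phi (j |: I) = lam j.
  rewrite inE => /andP[jI _].
  have hjI : #|j |: I| = p by rewrite cardsU1 jI add1n.
  have sjI : [set j] \subset j |: I by rewrite sub1set setU11.
  by rewrite -(pminor_seq phi d hjI sjI) enum_set1 setU1K.
have lam0 j : j \in I -> lam j = 0.
  rewrite -mem_enum => jI; case: p / hI phi hJ eJ @J' @C J'in @lam second first
    => phi hJ eJ J' C J'in lam _ _.
  have ltj : (index j (enum I) < #|I|)%N by rewrite cardE index_mem.
  have: 0 != lift ord0 (Ordinal ltj) by [].
  move=> ne; rewrite /lam (determinant_alternate ne) // => b.
  by rewrite !mxE /= nth_index.
transitivity (\sum_(j in J) lam j * \sum_i (mi_nth J' i == j)%:R * C i).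
  rewrite [RHS](bigID (fun j => j \in I)) /= [X in _ = X + _]big1 ?add0r; last first.
    by move=> j /andP[_ jI]; rewrite lam0 // mul0r.
  apply: eq_big => [j | j jJI]; first by rewrite inE andbC.
  by rewrite first // second //; move: jJI; rewrite inE => /andP[].
transitivity (\sum_i lam (mi_nth J' i) * C i).
  under eq_bigr => j _ do rewrite mulr_sumr.
  rewrite exchange_big /=; apply: eq_bigr => i _.
  rewrite (bigD1 (mi_nth J' i)) //= eqxx mul1r big1 ?addr0 // => j /andP[_ ne].
  by rewrite eq_sym (negPf ne) mul0r mulr0.
case: p / hI phi hJ eJ @J' @C J'in @lam second first lam0
  => phi hJ eJ J' C J'in lam _ _ _.
pose c (b : 'I_#|I|.+1) := (-1) ^+ b *
  \det (col' b (rowsub (fun i : 'I_#|I| => nth d (enum I) i) phi)).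
have lamE j : lam j = \sum_b phi j b * c b.
  rewrite /lam (expand_det_row _ 0); apply: eq_bigr => b _.
  rewrite mxE /cofactor add0n /c; congr (_ * (_ * \det _)).
  by apply/matrixP => x y; rewrite !mxE.
under eq_bigr => i _ do rewrite lamE mulr_suml.
rewrite exchange_big big1 //= => b _.
under eq_bigr => i _ do rewrite mulrAC.
rewrite -mulr_suml.
have -> : \sum_i phi (mi_nth J' i) b * C i =
  \det (rowsub (mi_nth J') (row_mx (col b phi) phi : 'M_(N, 1 + #|I|.+1))).
  by rewrite det_cons; apply: eq_bigr => i _; rewrite mxE.
rewrite -det_tr (determinant_alternate (i1 := lshift _ 0) (i2 := rshift 1 b)) ?mul0r //.
move=> i; rewrite [LHS]mxE [RHS]mxE [LHS]mxE [RHS]mxE.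
by rewrite (@row_mxEl _ _ 1) (@row_mxEr _ _ 1) mxE.
Qed.

Definition plev (k : fieldType) (A : comAlgType k) (N p : nat)
    (phi : 'M[A]_(N, p)) : plring k N p -> A :=
  mmap (in_alg A) (fun i => minor phi (enum_val i)).

HB.instance Definition _ (k : fieldType) (A : comAlgType k) (N p : nat)
  (phi : 'M[A]_(N, p)) := GRing.RMorphism.on (plev phi).

Lemma plev_var (k : fieldType) (A : comAlgType k) N p (phi : 'M[A]_(N, p)) J :
  plev phi (plvar k p J) = pminor phi J.
Proof.
rewrite /plvar /pminor; case: insub => [J'|]; last by rewrite rmorph0.
by rewrite /plev mmapX mmap1U enum_rankK.
Qed.

Lemma plev_rel (k : fieldType) (A : comAlgType k) N p (phi : 'M[A]_(N, p)) f :
  f \in @plideal k N p -> plev phi f = 0.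
Proof.
move/asboolP; elim=> [|a u v [I [J [hI hJ ->]]] _ IH]; first by rewrite rmorph0.
rewrite rmorphD rmorphM /= IH addr0 /plrel rmorph_sum /=.
under eq_bigr => j _ do rewrite !rmorphM /eps !rmorph_sign /= !plev_var.
by rewrite (pminor_rel phi hI hJ) mulr0.
Qed.

Lemma plideal_idealr (k : fieldType) (N p : nat) :
  idealr_closed (@plideal k N p).
Proof.
split.
- exact/asboolP/lspan0.
- apply/negP => /(plev_rel (A := k^o) (0 : 'M_(N, p)))/eqP.
  by rewrite rmorph1 oner_eq0.
- move=> a u v /asboolP Iu /asboolP Iv; apply/asboolP.
  elim: Iu => [|b x y Sx _ IH]; first by rewrite mulr0 add0r.
  have -> : a * (b *: x + y : (plring k N p)^o) + v =
            (a * b) *: (x : (plring k N p)^o) + (a * y + v).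
    by rewrite /GRing.scale /= mulrDr mulrA addrA.
  exact: lspanZD.
Qed.

HB.instance Definition _ (k : fieldType) (N p : nat) :=
  isIdealr.Build (plring k N p) (@plideal k N p) (@plideal_idealr k N p).

(* The homogeneous coordinate ring k[Delta] of the Grassmannian. *)
Definition kDelta (k : fieldType) (N p : nat) := 
  {ideal_quot (@plideal k N p : idealr {mpoly k[#|mindex N p|]})}.

HB.instance Definition _ k N p := GRing.ComNzRing.on (kDelta k N p).

Definition Delta (k : fieldType) (N p : nat) (J : {set 'I_N}) : kDelta k N p :=
  (\pi_(kDelta k N p) (plvar k p J))%qT.

(* Evaluation of k[Delta] at L = ker phi: Delta_J goes to the image of
   a_(j_1) /\ ... /\ a_(j_p) in Lambda^p (A^N / L) = Lambda^p A^p = A.  It is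
   independent of the representative (ev_pi) since minors satisfy the Pluecker
   relations (pminor_rel). *)
Definition ev (k : fieldType) (A : comAlgType k) (N p : nat)
    (phi : 'M[A]_(N, p)) (x : kDelta k N p) : A := plev phi (repr x).

Lemma ev_pi (k : fieldType) (A : comAlgType k) N p (phi : 'M[A]_(N, p)) f :
  ev phi (\pi_(kDelta k N p) f)%qT = plev phi f.
Proof.
have : (repr (\pi_(kDelta k N p) f)%qT == f %[mod kDelta k N p])%qT.
  by rewrite reprK.
rewrite -Quotient.idealrBE => /(plev_rel phi)/eqP.
by rewrite rmorphB subr_eq0 => /eqP.
Qed.

Lemma ev_Delta (k : fieldType) (A : comAlgType k) N p (phi : 'M[A]_(N, p))
  (J : mindex N p) : ev phi (Delta k p (val J)) = minor phi J.
Proof. by rewrite ev_pi plev_var /pminor valK. Qed.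

Lemma ev_is_zmod_morphism (k : fieldType) (A : comAlgType k) N p
  (phi : 'M[A]_(N, p)) : zmod_morphism (ev phi).
Proof.
elim/quotW=> x; elim/quotW=> y.
by rewrite -(raddfB (\pi_(kDelta k N p)%qT)) !ev_pi rmorphB.
Qed.

Lemma ev_is_monoid_morphism (k : fieldType) (A : comAlgType k) N p
  (phi : 'M[A]_(N, p)) : monoid_morphism (ev phi).
Proof.
split; first by rewrite -(rmorph1 (\pi_(kDelta k N p)%qT)) ev_pi rmorph1.
elim/quotW=> x; elim/quotW=> y.
by rewrite -(rmorphM (\pi_(kDelta k N p)%qT)) !ev_pi rmorphM.
Qed.

HB.instance Definition _ (k : fieldType) (A : comAlgType k) N p
    (phi : 'M[A]_(N, p)) :=
  GRing.isZmodMorphism.Build (kDelta k N p) A (ev phi)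
    (ev_is_zmod_morphism phi).
HB.instance Definition _ (k : fieldType) (A : comAlgType k) N p
    (phi : 'M[A]_(N, p)) :=
  GRing.isMonoidMorphism.Build (kDelta k N p) A (ev phi)
    (ev_is_monoid_morphism phi).

(* L is an A-point of the Grassmannian with free quotient, phi (acting on the
   right of row vectors) inducing an isomorphism from A^N / L to A^p.  The points
   of a standard chart, where some p of the a_j form a basis of A^N / L, are of
   this kind. *)
Definition trivialized_point (A : comNzRingType) (N p : nat)
    (L : 'rV[A]_N -> Prop) (phi : 'M[A]_(N, p)) : Prop :=
  (forall u : 'rV[A]_p, exists v : 'rV[A]_N, v *m phi = u) /\
  (forall v : 'rV[A]_N, L v <-> v *m phi = 0).

(* The identification of A^N with the forms of degree r. *)
Definition form (A : comNzRingType) (n r N : nat) (v : 'rV[A]_N) :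
    {mpoly A[n.+1]} := \sum_(h < N) v 0 h *: 'X_[alpha n.+1 r h].

(* The ideal of A[x_0..x_n] generated by L, which defines the restriction of the
   universal family to the A-point L. *)
Definition family_ideal (A : comNzRingType) (n r N : nat)
    (L : 'rV[A]_N -> Prop) : {mpoly A[n.+1]} -> Prop :=
  ideal_gen (fun g => exists2 v, L v & g = form n r v).

(* Lambda^m R^N, in the basis of the a_(h_1) /\ ... /\ a_(h_m) for increasing H;
   the coordinates of v_1 /\ ... /\ v_m are the m x m minors. *)
Definition extpow (R : comNzRingType) (N m : nat) := {ffun mindex N m -> R^o}.

HB.instance Definition _ (R : comNzRingType) N m :=
  GRing.Lmodule.on (extpow R N m).

Definition wedge (R : comNzRingType) (N m : nat) (v : 'I_m -> 'rV[R]_N) :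
    extpow R N m :=
  [ffun H : mindex N m => \det (\matrix_(i < m, j < m) v i 0 (mi_nth H j))].

(* The image of Lambda^m L in Lambda^m R^N; for the L considered, which are
   direct summands of R^N, it is Lambda^m L itself. *)
Definition extpow_sub (R : comNzRingType) (N m : nat) (L : 'rV[R]_N -> Prop) :
    extpow R N m -> Prop :=
  lspan (fun w => exists2 v : 'I_m -> 'rV[R]_N, (forall i, L (v i)) & w = wedge v).

Definition extpow_map (R S : comNzRingType) (f : R -> S) (N m : nat)
  (w : extpow R N m) : extpow S N m := [ffun H => f (w H)].

Definition delta1 (k : fieldType) (n r N p : nat) (K : mindex N (p + 1)) :
    {mpoly (kDelta k N p)[n.+1]} :=
  \sum_(h in val K)
    (eps _ (val K) [set h] * Delta k p (val K :\ h)) *: 'X_[alpha n.+1 r h].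

Definition delta (k : fieldType) (N p m : nat) (K : mindex N (p + m)) :
    extpow (kDelta k N p) N m :=
  \sum_(H : mindex N m | val H \subset val K)
    (eps _ (val K) (val H) * Delta k p (val K :\: val H)) *:
      wedge (fun i : 'I_m => delta_mx 0 (mi_nth H i)).

(* Main.v *)
(* Over a chart, L is the kernel of a split surjection phi : A^N -> A^p with
   section s.  The coordinate of delta_K at H is the K-minor of the matrix
   (E_H | phi), where the columns of E_H are the unit vectors indexed by H.
   - Cauchy-Binet for the product of (v ; s), with v_1, ..., v_m in L as first
     rows, by (E_H | phi), which is block triangular, writes v_1 /\ ... /\ v_m as
     a combination of the delta_K.
   - Column operations replace E_H by P E_H with P = 1 - phi s, whose rows lie
     in L; the Laplace expansion along the first m columns then writes delta_K
     as a combination of wedges of rows of P.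
   The statement on the ideal of F is the case m = 1. *)
Require Import Defs.
From mathcomp Require Import all_boot all_order all_algebra all_fingroup.
From mathcomp.multinomials Require Import mpoly.

Set Implicit Arguments.
Unset Strict Implicit.
Unset Printing Implicit Defensive.

Import GRing.Theory.

Local Open Scope ring_scope.

(** * Multi-indices as increasing enumerations *)

Lemma mi_nth_inj N m (H : mindex N m) : injective (mi_nth H).
Proof. by move=> i j /enum_val_inj/cast_ord_inj. Qed.

Lemma mem_mi_nth N m (H : mindex N m) i : mi_nth H i \in val H.
Proof. exact: (enum_valP (A := val H)). Qed.

Lemma mi_nthP N m (H : mindex N m) a :
  a \in val H -> exists i, a = mi_nth H i.
Proof.
move=> aH; exists (cast_ord (eqP (valP H)) (enum_rank_in aH a)).
by rewrite /mi_nth cast_ordK enum_rankK_in.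
Qed.

Lemma mi_nth_nth N m (H : mindex N m) (d : 'I_N) i :
  mi_nth H i = nth d (enum (val H)) i.
Proof. by rewrite /mi_nth (enum_val_nth d). Qed.

(** * Alternating sums, Cauchy-Binet and partial Laplace expansion *)

Section AlternatingSums.
Variables (A : comNzRingType) (N m : nat).

(** By the next two lemmas, this parametrizes the injective maps bijectively by their image and a
    permutation. *)
Let reorder (Hs : mindex N m * 'S_m) : {ffun 'I_m -> 'I_N} :=
  [ffun i => mi_nth Hs.1 (Hs.2 i)].

Let reorder_inj : injective reorder.
Proof.
have imE Hs : reorder Hs @: 'I_m = val Hs.1.
  apply/setP => a; apply/imsetP/idP => [[i _ ->]|].
    by rewrite ffunE mem_mi_nth.
  by move=> /mi_nthP[i ->]; exists (Hs.2^-1 i)%g; rewrite // ffunE permKV.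
move=> [H s] [H' s'] e.
have eH : H = H' by apply: val_inj; rewrite -(imE (H, s)) e imE.
rewrite -{}eH in e *; congr (_, _); apply/permP => i.
by move/ffunP: e => /(_ i); rewrite !ffunE; apply: mi_nth_inj.
Qed.

Let reorder_surj (f : {ffun 'I_m -> 'I_N}) :
  injective f -> exists Hs, f = reorder Hs.
Proof.
move=> f_inj; have cH : #|f @: 'I_m| == m by rewrite card_imset // card_ord.
pose H : mindex N m := Sub (f @: 'I_m) cH.
have /fin_all_exists[s sE] i : exists j, f i = mi_nth H j.
  by apply: mi_nthP; rewrite imset_f.
have s_inj : injective s by move=> i j e; apply: f_inj; rewrite !sE e.
by exists (H, perm s_inj); apply/ffunP => i; rewrite ffunE permE.
Qed.

(** Only injective maps contribute. Those with image [H] differ by a permutation, whose sign comes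
    out of [g] and completes the Leibniz formula for the [H]-minor of [B]. Both expansions below are
    instances. *)
Lemma sum_alternating (B : 'M[A]_(N, m)) (g : {ffun 'I_m -> 'I_N} -> A) :
    (forall f : {ffun 'I_m -> 'I_N}, ~~ injectiveb f -> g f = 0) ->
    (forall (f : {ffun 'I_m -> 'I_N}) (s : 'S_m), g [ffun i => f (s i)] = (-1) ^+ s * g f) ->
  \sum_(f : {ffun 'I_m -> 'I_N}) (\prod_i B (f i) i) * g f =
  \sum_(H : mindex N m) \det (rowsub (mi_nth H) B) * g [ffun i => mi_nth H i].
Proof.
move=> g0 gs.
rewrite (bigID (fun f : {ffun 'I_m -> 'I_N} => injectiveb f)) /= [X in _ + X]big1 ?addr0; last first.
  by move=> f /g0->; rewrite mulr0.
rewrite (eq_bigl (fun f => f \in reorder @: predT)); last first.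
  move=> f; apply/injectiveP/imsetP => [/reorder_surj[Hs ->]|[[H s] _ ->] i j].
    by exists Hs.
  by rewrite !ffunE => /mi_nth_inj/perm_inj.
rewrite big_imset /=; last by move=> ? ? _ _; apply: reorder_inj.
rewrite -(pair_big predT predT (fun H s => (\prod_i B (reorder (H, s) i) i) * g (reorder (H, s)))) /=.
(* The products [B (f i) i] move the row index, so they are Leibniz terms of the transpose. *)
apply: eq_bigr => H _; rewrite -det_tr mulr_suml; apply: eq_bigr => s _.
have -> : reorder (H, s) = [ffun i => [ffun i => mi_nth H i] (s i)].
  by apply/ffunP => i; rewrite !ffunE.
rewrite gs mulrA [_ * (-1) ^+ s]mulrC; congr (_ * _ * _).
by apply: eq_bigr => i _; rewrite !ffunE !mxE.
Qed.

End AlternatingSums.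

Lemma rowsub_row_mx (A : Type) N n m p (f : 'I_n -> 'I_N)
    (X : 'M[A]_(N, m)) (Y : 'M[A]_(N, p)) :
  rowsub f (row_mx X Y) = row_mx (rowsub f X) (rowsub f Y).
Proof. by apply/matrixP => i j; rewrite !mxE; case: splitP => k _; rewrite mxE. Qed.

Lemma det_rowsub_perm (A : comNzRingType) N m (B : 'M[A]_(N, m))
    (f : 'I_m -> 'I_N) (s : 'S_m) :
  \det (rowsub (f \o s) B) = (-1) ^+ s * \det (rowsub f B).
Proof.
rewrite -det_perm -det_mulmx -row_permE; congr (\det _).
by apply/matrixP => i j; rewrite !mxE.
Qed.

(** Multilinearity in the rows of [B *m C], each of which is a combination of rows of [C]; [f]
    records the row chosen in each factor. *)
Lemma det_mulmx_ffun (A : comNzRingType) N m (B : 'M[A]_(m, N)) (C : 'M[A]_(N, m)) :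
  \det (B *m C) =
  \sum_(f : {ffun 'I_m -> 'I_N}) (\prod_i B i (f i)) * \det (rowsub f C).
Proof.
under [RHS]eq_bigr => f _ do rewrite mulr_sumr.
rewrite exchange_big; apply: eq_bigr => s _ /=.
under [RHS]eq_bigr => f _ do rewrite mulrCA -big_split /=.
rewrite -mulr_sumr; congr (_ * _).
under [RHS]eq_bigr => f _ do under eq_bigr => i _ do rewrite mxE.
rewrite -(bigA_distr_bigA (fun i j => B i j * C j (s i))).
by apply: eq_bigr => i _; rewrite mxE.
Qed.

Lemma cauchy_binet (A : comNzRingType) N m (B : 'M[A]_(m, N)) (C : 'M[A]_(N, m)) :
  \det (B *m C) =
  \sum_(H : mindex N m) \det (colsub (mi_nth H) B) * minor C H.
Proof.
rewrite det_mulmx_ffun.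
(* The double transpose gives the products the index order of [sum_alternating]. *)
have -> : B = B^T^T by rewrite trmxK.
under eq_bigr => f _ do under eq_bigr => i _ do rewrite mxE.
rewrite (sum_alternating _ (g := fun f => \det (rowsub f C))).
- apply: eq_bigr => H _; rewrite trmxK /minor; congr (_ * _).
    by rewrite -det_tr; congr (\det _); apply/matrixP => i j; rewrite !mxE.
  by congr (\det _); apply/matrixP => i j; rewrite !mxE ffunE.
- move=> f /injectivePn[i [j ne e]].
  by rewrite (determinant_alternate ne) // => l; rewrite !mxE e.
- move=> f s; rewrite -det_rowsub_perm; congr (\det _).
  by apply/matrixP => i j; rewrite !mxE ffunE.
Qed.

(** Multilinearity in the first [m] columns only. After transposition the Leibniz product runs over
    columns and splits into the two blocks. *)
Lemma det_row_mx_ffun (A : comNzRingType) N m p (C : 'M[A]_(m + p, N))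
    (X : 'M[A]_(N, m)) (D : 'M[A]_(m + p, p)) :
  \det (row_mx (C *m X) D) =
  \sum_(f : {ffun 'I_m -> 'I_N}) (\prod_i X (f i) i) * \det (row_mx (colsub f C) D).
Proof.
under [RHS]eq_bigr => f _ do rewrite -det_tr mulr_sumr.
rewrite exchange_big -det_tr; apply: eq_bigr => s _ /=.
under [RHS]eq_bigr => f _ do rewrite mulrCA.
rewrite -mulr_sumr; congr (_ * _); rewrite big_split_ord /=.
under [RHS]eq_bigr => f _ do rewrite big_split_ord mulrA -big_split /=.
under [RHS]eq_bigr => f _.
  rewrite (eq_bigr (fun i => X (f i) i * C (s (lshift p i)) (f i))); last first.
    by move=> i _; rewrite mxE row_mxEl mxE.
  rewrite (eq_bigr (fun i => D (s (rshift m i)) i)); last first.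
    by move=> i _; rewrite mxE row_mxEr.
  over.
rewrite -mulr_suml; congr (_ * _); last first.
  by apply: eq_bigr => i _; rewrite mxE row_mxEr.
rewrite -(bigA_distr_bigA (fun i j => X j i * C (s (lshift p i)) j)).
apply: eq_bigr => i _; rewrite mxE row_mxEl mxE.
by apply: eq_bigr => j _; rewrite mulrC.
Qed.

(** The columns of [X] are combinations of unit columns. The cofactors are kept as minors with unit
    columns, the form taken by the coordinates of [delta] in [ev_delta_minor]. *)
Lemma laplace_minor (A : comNzRingType) N m p (X : 'M[A]_(N, m))
    (phi : 'M[A]_(N, p)) (K : mindex N (m + p)) :
  minor (row_mx X phi) K =
  \sum_(H : mindex N m) \det (rowsub (mi_nth H) X) *
    minor (row_mx (colsub (mi_nth H) 1%:M) phi) K.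
Proof.
pose g (f : {ffun 'I_m -> 'I_N}) := minor (row_mx (colsub f 1%:M) phi) K.
have gE (f : {ffun 'I_m -> 'I_N}) : g f =
    \det (row_mx (colsub f (rowsub (mi_nth K) 1%:M)) (rowsub (mi_nth K) phi)).
  rewrite /g /minor rowsub_row_mx; congr (\det (row_mx _ _)).
  by apply/matrixP => i j; rewrite !mxE.
rewrite {1}/minor rowsub_row_mx -[rowsub _ X]mul1mx.
rewrite -{1}[X]mul1mx -mul_rowsub_mx mulmxA mul1mx det_row_mx_ffun.
under eq_bigr => f _ do rewrite -gE.
rewrite sum_alternating.
- apply: eq_bigr => H _; congr (_ * minor (row_mx _ _) K).
  by apply/matrixP => i j; rewrite !mxE ffunE.
- move=> f /injectivePn[i [j ne e]]; rewrite gE -det_tr.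
  have ne' : lshift p i != lshift p j by rewrite (inj_eq (@lshift_inj _ _)).
  rewrite (determinant_alternate ne') // => l.
  by rewrite mxE [RHS]mxE !row_mxEl !mxE e.
(* Permuting the first [m] columns is right multiplication by a block diagonal matrix with blocks a
   permutation matrix and [1]. The inverse of [s] enters through [col_permE]. *)
- move=> f s; rewrite !gE -odd_permV -det_perm.
  rewrite -[\det (perm_mx _)]mulr1 -(det1 A p) -(det_ublock _ 0) mulrC.
  rewrite -det_mulmx mul_row_block !mulmx0 !mulmx1 addr0 add0r -col_permE.
  congr (\det (row_mx _ _)); apply/matrixP => i j.
  by rewrite !mxE ffunE.
Qed.

(** * Minors with unit columns *)

Lemma eps_sqr (A : comNzRingType) N (K H : {set 'I_N}) : eps A K H * eps A K H = 1.
Proof. by rewrite /eps -expr2 sqrr_sign. Qed.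

Lemma wedge_delta (A : comNzRingType) N m (H J : mindex N m) :
  wedge (fun i : 'I_m => delta_mx 0 (mi_nth H i) : 'rV[A]_N) J = (J == H)%:R.
Proof.
rewrite ffunE; have [->|ne] := eqVneq J H.
  rewrite -[RHS](det1 A m); congr (\det _); apply/matrixP => i j.
  by rewrite !mxE eqxx (inj_eq (@mi_nth_inj _ _ H)) eq_sym.
(* Distinct sets of equal size are not nested: an element of [J] outside [H] gives a zero column. *)
have /subsetPn[_ /mi_nthP[j ->] jP] : ~~ (val J \subset val H).
  apply: contraNN ne => sJH; rewrite -(inj_eq val_inj) eqEcard sJH.
  by rewrite (eqP (valP J)) (eqP (valP H)) leqnn.
rewrite (expand_det_col _ j) big1 // => i _; rewrite !mxE eqxx /=.
by case: eqP => [e|_]; rewrite ?mul0r //; rewrite e mem_mi_nth in jP.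
Qed.

(** Listing the rows of [H] before those of [K \ H] costs the sign [eps] and makes the matrix block
    triangular with an identity block. If [H] is not inside [K], some unit column vanishes on the
    rows of [K]. *)
Lemma minor_unit_columns (A : comNzRingType) N m p (phi : 'M[A]_(N, p))
    (K : mindex N (m + p)) (H : mindex N m) : (0 < m)%N ->
  minor (row_mx (colsub (mi_nth H) 1%:M) phi) K =
  if val H \subset val K then eps A (val K) (val H) * pminor phi (val K :\: val H)
  else 0.
Proof.
(* [m_gt0] provides an element of ['I_N], the default value for [nth]. *)
move=> m_gt0; pose d := mi_nth H (Ordinal m_gt0).
have [sHK|] := boolP (val H \subset val K); last first.
  case/subsetPn => h /mi_nthP[j ->] hK.
  rewrite /minor (expand_det_col _ (lshift p j)) big1 // => i _.
  rewrite mxE row_mxEl !mxE; case: eqP => [e|_]; last by rewrite mul0r.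
  by rewrite -e mem_mi_nth in hK.
have cKH : #|val K :\: val H| = p.
  by rewrite cardsD (setIidPr sHK) (eqP (valP K)) (eqP (valP H)) addKn.
(* [minor_seq] describes [eps] times the minor, so a second factor [eps] is inserted. *)
transitivity (eps A (val K) (val H) * (eps A (val K) (val H) *
    minor (row_mx (colsub (mi_nth H) 1%:M) phi) K)).
  by rewrite mulrA eps_sqr mul1r.
congr (_ * _).
have := minor_seq (row_mx (colsub (mi_nth H) 1%:M) phi) d (valP K) sHK.
have -> : Sub (val K) (valP K) = K by apply: val_inj.
move=> <-; rewrite (pminorE _ d cKH) rowsub_row_mx.
set f := fun i : 'I_(m + p) => _.
have szH : size (enum (val H)) = m by rewrite -cardE (eqP (valP H)).
have fl i : f (lshift p i) = mi_nth H i.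
  by rewrite /f nth_cat /= szH ltn_ord (mi_nth_nth _ d).
have fr i : f (rshift m i) = nth d (enum (val K :\: val H)) i.
  by rewrite /f nth_cat /= szH ltnNge leq_addr /= addKn.
have -> : row_mx (rowsub f (colsub (mi_nth H) 1%:M)) (rowsub f phi) =
    block_mx 1%:M (rowsub (f \o lshift p) phi) 0 (rowsub (f \o @rshift m p) phi).
  apply/matrixP => i j.
  case: (split_ordP i) => {}i ->; case: (split_ordP j) => {}j ->.
  - by rewrite block_mxEul row_mxEl !mxE fl (inj_eq (@mi_nth_inj _ _ H)).
  - by rewrite block_mxEur row_mxEr !mxE.
  - rewrite block_mxEdl row_mxEl !mxE fr; case: eqP => // e.
    have : nth d (enum (val K :\: val H)) i \in val K :\: val H.
      by rewrite -mem_enum mem_nth // -cardE cKH.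
    by rewrite e inE mem_mi_nth.
  - by rewrite block_mxEdr row_mxEr !mxE.
rewrite det_ublock det1 mul1r; congr (\det _).
by apply/matrixP => i j; rewrite !mxE /= fr.
Qed.

(** * Linear combinations *)

Lemma lspan_linear (R : pzRingType) (V : lmodType R) (S : V -> Prop) (a : R) (u v : V) :
  lspan S u -> lspan S v -> lspan S (a *: u + v).
Proof.
elim=> [|b x y Sx _ IH] Sv; first by rewrite scaler0 add0r.
by rewrite scalerDr scalerA -addrA; apply: lspanZD => //; apply: IH.
Qed.

Lemma lspan_gen (R : pzRingType) (V : lmodType R) (S : V -> Prop) (u : V) :
  S u -> lspan S u.
Proof.
by move=> Su; rewrite -[u]scale1r -[1 *: u]addr0; apply/lspanZD/lspan0.
Qed.

Lemma lspan_sum (R : pzRingType) (V : lmodType R) (S : V -> Prop)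
    (I : finType) (a : I -> R) (u : I -> V) :
  (forall i, S (u i)) -> lspan S (\sum_i a i *: u i).
Proof.
move=> Su; elim/big_rec: _ => [|i v _ Sv]; first exact: lspan0.
exact: lspanZD.
Qed.

Lemma lspan_sub (R : pzRingType) (V : lmodType R) (S T : V -> Prop) :
  (forall u, S u -> lspan T u) -> forall u, lspan S u -> lspan T u.
Proof.
move=> ST u; elim=> [|a v w Sv _ IH]; first exact: lspan0.
exact/lspan_linear/IH/ST.
Qed.

(** * Exterior powers of a point of a chart *)

Section Charts.
Variables (k : fieldType) (A : comAlgType k) (N p : nat).
Variables (L : 'rV[A]_N -> Prop) (phi : 'M[A]_(N, p)).

Lemma ev_eps (K H : {set 'I_N}) : ev phi (eps _ K H) = eps A K H.
Proof. by rewrite /eps rmorph_sign. Qed.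

Lemma ev_Delta_set (J : {set 'I_N}) : ev phi (Delta k p J) = pminor phi J.
Proof. by rewrite ev_pi plev_var. Qed.

Lemma ev_delta m (K : mindex N (p + m)) (H : mindex N m) :
  extpow_map (ev phi) (delta k K) H =
  if val H \subset val K then eps A (val K) (val H) * pminor phi (val K :\: val H)
  else 0.
Proof.
rewrite ffunE /delta sum_ffunE rmorph_sum /=.
transitivity (\sum_(J : mindex N m | val J \subset val K)
    eps A (val K) (val J) * pminor phi (val K :\: val J) * (H == J)%:R).
  apply: eq_bigr => J _.
  have -> (a : kDelta k N p) (w : extpow (kDelta k N p) N m) :
    (a *: w) H = a * w H by rewrite ffunE.
  by rewrite wedge_delta !rmorphM /= rmorph_nat ev_eps ev_Delta_set.
have [sHK|nsHK] := ifP.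
  rewrite (bigD1 H) //= eqxx mulr1 big1 ?addr0 // => J /andP[_ ne].
  by rewrite eq_sym (negPf ne) mulr0.
rewrite big1 // => J sJK; case: eqP => [e|_]; last by rewrite mulr0.
by rewrite e sJK in nsHK.
Qed.

(** [K] and [K'] are the same set: [delta] counts its elements as [p + m], the block matrix as
    [m + p]. *)
Lemma ev_delta_minor m (K : mindex N (p + m)) (K' : mindex N (m + p))
    (H : mindex N m) : (0 < m)%N -> val K = val K' ->
  extpow_map (ev phi) (delta k K) H =
  minor (row_mx (colsub (mi_nth H) 1%:M) phi) K'.
Proof. by move=> m_gt0 eK; rewrite minor_unit_columns // -eK ev_delta. Qed.

Hypothesis L_phi : trivialized_point L phi.

Lemma section_exists : exists s : 'M[A]_(p, N), s *m phi = 1%:M.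
Proof.
have [surj _] := L_phi; have /fin_all_exists[s sE] i := surj (row i 1%:M).
exists (\matrix_i s i); apply/row_matrixP => i.
by rewrite row_mul rowK sE.
Qed.

Let chart_gen m (u : extpow A N m) : Prop :=
  exists K : mindex N (p + m), u = extpow_map (ev phi) (delta k K).

Lemma wedge_in_span m (v : 'I_m -> 'rV[A]_N) : (0 < m)%N ->
  (forall i, L (v i)) -> lspan (@chart_gen m) (wedge v).
Proof.
move=> m_gt0 Lv; have [s sphi] := section_exists.
pose V : 'M[A]_(m, N) := \matrix_i v i.
have Vphi : V *m phi = 0.
  apply/row_matrixP => i; rewrite row_mul rowK row0.
  by have [_ /(_ (v i))[+ _]] := L_phi; apply.
have castK (K : mindex N (m + p)) : #|val K| == (p + m)%N.
  by rewrite (eqP (valP K)) addnC.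
pose dK (K : mindex N (m + p)) : mindex N (p + m) := Sub (val K) (castK K).
have -> : wedge v = \sum_(K : mindex N (m + p))
    \det (colsub (mi_nth K) (col_mx V s)) *: extpow_map (ev phi) (delta k (dK K)).
  apply/ffunP => H; rewrite sum_ffunE.
  (* Since [V *m phi = 0] and [s *m phi = 1], the product is block lower triangular, its diagonal
     blocks being the columns [H] of [V] and the identity. *)
  transitivity (\det (col_mx V s *m row_mx (colsub (mi_nth H) 1%:M) phi)).
    rewrite mul_col_row Vphi sphi det_lblock det1 mulr1 ffunE.
    congr (\det _); apply/matrixP => i j.
    by rewrite mulmx_colsub mulmx1 !mxE.
  rewrite cauchy_binet; apply: eq_bigr => K _.
  by rewrite [RHS]ffunE (ev_delta_minor (K' := K)).
by apply: lspan_sum => K; exists (dK K).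
Qed.

Lemma delta_in_extpow m (K : mindex N (p + m)) : (0 < m)%N ->
  extpow_sub L (extpow_map (ev phi) (delta k K)).
Proof.
move=> m_gt0; have [s sphi] := section_exists.
have cK : #|val K| == (m + p)%N by rewrite (eqP (valP K)) addnC.
pose K' : mindex N (m + p) := Sub (val K) cK.
(* The projection of [A^N] onto [L] along the row space of [s], acting on row vectors. *)
pose P : 'M[A]_N := 1%:M - phi *m s.
have -> : extpow_map (ev phi) (delta k K) = \sum_(J : mindex N m)
    minor (row_mx (colsub (mi_nth J) 1%:M) phi) K' *:
    wedge (fun i => row (mi_nth J i) P).
  apply/ffunP => H; rewrite (ev_delta_minor (K' := K')) // sum_ffunE.
  transitivity (minor (row_mx (colsub (mi_nth H) P) phi) K').
    (* Subtracting combinations of the columns of [phi] from the unit columns is multiplication by a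
       unitriangular matrix, of determinant 1. *)
    have -> : row_mx (colsub (mi_nth H) P) phi =
        row_mx (colsub (mi_nth H) 1%:M) phi *m
        block_mx 1%:M 0 (- colsub (mi_nth H) s) 1%:M.
      rewrite mul_row_block !mulmx1 mulmx0 add0r mulmxN mulmx_colsub.
      congr row_mx; apply/matrixP => i j.
      by rewrite !mxE.
    by rewrite /minor -mul_rowsub_mx det_mulmx det_lblock !det1 !mulr1.
  (* The cofactor of [J] does not depend on [H], and the other factor is the [H]-coordinate of a
     wedge of rows of [P]; hence the coordinatewise expansions form one identity in the exterior
     power. *)
  rewrite laplace_minor; apply: eq_bigr => J _.
  rewrite [RHS]ffunE [wedge _ _]ffunE mulrC; congr (_ * \det _).
  by apply/matrixP => i j; rewrite !mxE.
apply: lspan_sum => J; exists (fun i => row (mi_nth J i) P) => // i.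
have [_ /(_ (row (mi_nth J i) P))[_]] := L_phi; apply.
by rewrite -row_mul mulmxBl mul1mx -mulmxA sphi mulmx1 subrr row0.
Qed.

Lemma extpow_sub_delta m (w : extpow A N m) : (0 < m)%N ->
  extpow_sub L w <-> lspan (@chart_gen m) w.
Proof.
move=> m_gt0; split; apply: lspan_sub => u.
  by move=> [v Lv ->]; apply: wedge_in_span.
by move=> [K ->]; apply: delta_in_extpow.
Qed.

(** * Degree one: the ideal of the universal family *)

Section Forms.
Variables (n r : nat).

Let singleton (h : 'I_N) : mindex N 1 := Sub [set h] (introT eqP (cards1 h)).

(** The first exterior power is [A^N], so [form1] is [form] read through this identification. It
    carries the evaluated [delta] to the evaluated [delta1]. *)
Let form1 (w : extpow A N 1) : {mpoly A[n.+1]} :=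
  \sum_h w (singleton h) *: 'X_[alpha n.+1 r h].

Let form1_wedge (v : 'I_1 -> 'rV[A]_N) : form1 (wedge v) = Defs.form n r (v 0).
Proof.
apply: eq_bigr => h _; rewrite ffunE det_mx11 mxE; congr (v 0 _ _ *: _).
by have := mem_mi_nth (singleton h) 0; rewrite inE => /eqP.
Qed.

Let form1_delta (K : mindex N (p + 1)) :
  form1 (extpow_map (ev phi) (delta k K)) = map_mpoly (ev phi) (delta1 k n r K).
Proof.
rewrite /delta1 rmorph_sum [RHS]big_mkcond; apply: eq_bigr => h _ /=.
rewrite ev_delta /= sub1set; case: ifP => _; last by rewrite scale0r.
by rewrite map_mpolyZ map_mpolyX rmorphM /= ev_eps ev_Delta_set.
Qed.

(** Scalars of [A] act on forms as constant polynomials, so a span over [A] lands in the ideal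
    generated over the polynomial ring. *)
Let form1_span (S : extpow A N 1 -> Prop) (T : {mpoly A[n.+1]} -> Prop) w :
  (forall u, S u -> ideal_gen T (form1 u)) -> lspan S w -> ideal_gen T (form1 w).
Proof.
move=> ST; elim=> [|a u v Su _ IH].
  rewrite /form1 big1 => [|h _]; first exact: lspan0.
  by rewrite ffunE scale0r.
have -> : form1 (a *: u + v) = a%:MP * form1 u + form1 v.
  rewrite mul_mpolyC /form1 scaler_sumr -big_split; apply: eq_bigr => h _ /=.
  by rewrite !ffunE scalerDl scalerA.
exact/lspan_linear/IH/ST.
Qed.

Lemma family_ideal_delta1 (f : {mpoly A[n.+1]}) :
  family_ideal r L f <->
  ideal_gen (fun g => exists K : mindex N (p + 1),
    g = map_mpoly (ev phi) (delta1 k n r K)) f.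
Proof.
split; apply: lspan_sub => g.
  (* A vector of [L] is its own wedge of length one. *)
  move=> [v Lv ->]; rewrite -(form1_wedge (fun=> v)).
  apply: (form1_span (S := @chart_gen 1)); last exact: wedge_in_span.
  by move=> _ [K ->]; apply: lspan_gen; exists K; rewrite form1_delta.
move=> [K ->]; rewrite -form1_delta.
apply: form1_span (delta_in_extpow K isT) => _ [v Lv ->].
by apply: lspan_gen; exists (v 0); rewrite ?form1_wedge.
Qed.

End Forms.

End Charts.

Theorem theorem5p10 (k : fieldType) (n : nat) (hp : {poly rat}) (r p : nat)
    (char_k : [pchar k] =i pred0)
    (hp_hilbert : exists2 I : {mpoly k[n.+1]} -> Prop,
        homogeneous_ideal I & hilbert_polynomial I hp)
    (r_gotzmann : gotzmann_number hp r)
    (p_value : hp.[r%:R] = p%:R) :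
  let N := 'C(n + r, n) in
  let q := (N - p)%N in
  (forall (A : comAlgType k), noetherian A ->
     forall (L : 'rV[A]_N -> Prop) (phi : 'M[A]_(N, p)),
       trivialized_point L phi ->
       forall f : {mpoly A[n.+1]},
         family_ideal r L f <->
         ideal_gen (fun g => exists K : mindex N (p + 1),
           g = map_mpoly (ev phi) (delta1 k n r K)) f)
  /\
  (forall m : nat, (1 <= m <= q)%N ->
     forall (A : comAlgType k), noetherian A ->
     forall (L : 'rV[A]_N -> Prop) (phi : 'M[A]_(N, p)),
       trivialized_point L phi ->
       forall w : extpow A N m,
         extpow_sub L w <->
         lspan (fun u => exists K : mindex N (p + m),
           u = extpow_map (ev phi) (delta k K)) w).
Proof.
move=> N q; split=> [A _ L phi Lphi f | m /andP[m_gt0 _] A _ L phi Lphi w].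
  exact: family_ideal_delta1.
exact: extpow_sub_delta.
Qed.
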